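(* For a positive integer $N$, let $\mathcal{C}(N)$ denote the total number of subsets of $\mathcal{H}=\{1,2,\ldots,N\}$ that are complete in $\mathbb{Z}$. Then $$\mathcal{C}(N)\gg N\log N.$$
   Context: A finite set of integers $\mathcal{A}=\{a_1,a_2,\ldots,a_n\}$ (with distinct elements $a_1,\ldots,a_n$) is said to be complete in $\mathbb{Z}$ if there exists some $b\in\mathbb{Z}$ such that $\prod_{i=1}^{n}a_i=b\sum_{i=1}^{n}a_i$. The notation $f(N)\gg g(N)$ means that there is an absolute constant $c>0$ such that $f(N)\ge c\,g(N)$ for all sufficiently large $N$. *)

(* Defs.v *)
From mathcomp Require Import all_boot all_order all_algebra.
From mathcomp Require Import finmap.
From mathcomp Require Import boolp classical_sets reals filter topology sequences exp.

Set Implicit Arguments.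
Unset Strict Implicit.
Unset Printing Implicit Defensive.

Import Order.TTheory GRing.Theory Num.Theory.

Local Open Scope classical_set_scope.
Local Open Scope fset_scope.
Local Open Scope ring_scope.

(* The empty set is not complete: its product is 1 and its sum is 0. *)
Definition complete_set (A : {fset int}) : Prop :=
  exists b : int, \prod_(a <- A) a = b * \sum_(a <- A) a.

Definition interval1 (N : nat) : {fset int} := [fset k%:Z | k in iota 1 N].

Definition complete_count (N : nat) : nat :=
  #|` [fset A in fpowerset (interval1 N) | `[< complete_set A >]]|.

Definition asymp_ge (R : realType) (f g : nat -> R) : Prop :=
  exists2 c : R, 0 < c & \forall N \near \oo, c * g N <= f N.

(* Main.v *)
Require Import Defs.
From mathcomp Require Import all_boot all_order all_algebra.
From mathcomp Require Import finmap.
From mathcomp Require Import boolp classical_sets reals filter topology sequences exp.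
From mathcomp Require Import zify ring lra.

Import Order.TTheory GRing.Theory Num.Theory.
Local Open Scope ring_scope.

(** A three-element set of the form [{a, b, a + b}] has sum [2 (a + b)] and
    product [a b (a + b)], so it is complete as soon as [a] is even.  There are
    quadratically many such sets inside [{1, ..., N}]: letting [a] run over the
    even numbers up to [2 m] and [b] over [2 m + 1, ..., 3 m], with
    [m = N %/ 5], gives [m ^ 2] pairwise distinct ones
    ([sqr_le_complete_count]).  Since [ln N <= N], the quadratic bound
    dominates [N ln N]. *)

Local Open Scope fset_scope.

Definition sum_triple (a b : nat) : {fset int} :=
  a%:Z |` (b%:Z |` [fset (a + b)%N%:Z]).

Lemma in_sum_triple (a b x : nat) :
  (x%:Z \in sum_triple a b) = [|| x == a, x == b | x == (a + b)%N].
Proof. by rewrite !inE. Qed.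

Lemma sum_triple_complete (k b : nat) :
  (0 < k)%N -> (k.*2 < b)%N -> complete_set (sum_triple k.*2 b).
Proof.
move=> k_gt0 lt_kb.
have a_notin : k.*2%:Z \notin b%:Z |` [fset (k.*2 + b)%N%:Z].
  by rewrite !inE; lia.
have b_notin : b%:Z \notin [fset (k.*2 + b)%N%:Z] by rewrite !inE; lia.
(* The quotient a b (a + b) / (2 (a + b)) with a = 2 k. *)
exists (k%:Z * b%:Z).
rewrite /sum_triple !big_fsetU1 //= !big_seq_fset1 PoszD.
have -> : k.*2%:Z = 2 * k%:Z by lia.
ring.
Qed.

(** The separation [a <= n < b] makes [a] recognisable as the only element not
    exceeding [n]; then [b] and [a + b] cannot be exchanged, as [a > 0]. *)
Lemma sum_triple_inj (n a b a' b' : nat) :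
    (0 < a <= n)%N -> (n < b)%N -> (0 < a' <= n)%N -> (n < b')%N ->
  sum_triple a b = sum_triple a' b' -> a = a' /\ b = b'.
Proof.
move=> Ha Hb Ha' Hb' eqT.
have mem x := congr1 (fun A : {fset int} => x%:Z \in A) eqT.
have := mem a; have := mem b; have := mem b'.
rewrite /= !in_sum_triple; lia.
Qed.

Lemma sum_triple_sub_interval1 (a b N : nat) :
  (0 < a)%N -> (0 < b)%N -> (a + b <= N)%N ->
  sum_triple a b `<=` interval1 N.
Proof.
move=> a_gt0 b_gt0 leN; apply/fsubsetP => x.
have memI (y : nat) : (0 < y <= N)%N -> y%:Z \in interval1 N.
  by move=> Hy; apply/imfsetP; exists y => //=; rewrite mem_iota; lia.
by rewrite !inE => /or3P[] /eqP ->; apply: memI; lia.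
Qed.

Lemma sqr_le_complete_count (N : nat) : ((N %/ 5) ^ 2 <= complete_count N)%N.
Proof.
set m := (N %/ 5)%N.
have le_5m : (5 * m <= N)%N by rewrite /m; lia.
pose T (p : 'I_m * 'I_m) := sum_triple p.1.+1.*2 (m.*2 + p.2.+1)%N.
have T_inj : injective T.
  move=> [i j] [i' j'] eqT.
  have [lt_i lt_i'] := (ltn_ord i, ltn_ord i').
  have [||||/= eq_i eq_j] := @sum_triple_inj m.*2 _ _ _ _ _ _ _ _ eqT => /=;
    try lia.
  by congr pair; apply: val_inj => /=; lia.
have -> : (m ^ 2)%N = #|` [fset T p | p in predT]|.
  by rewrite card_imfset //= -cardE card_prod card_ord.
apply/fsubset_leq_card/fsubsetP => _ /imfsetP[[i j] _ ->].
have [lt_i lt_j] := (ltn_ord i, ltn_ord j).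
rewrite !inE /= fpowersetE; apply/andP; split.
  by apply: sum_triple_sub_interval1 => /=; lia.
by apply/asboolP/sum_triple_complete => /=; lia.
Qed.

Local Close Scope fset_scope.

Theorem theorem4p2 (R : realType) :
  asymp_ge (fun N : nat => (complete_count N)%:R : R)
           (fun N : nat => N%:R * ln (N%:R : R)).
Proof.
(* N %/ 5 >= N / 10 once N >= 5, whence the constant 1 / 10 ^ 2. *)
exists (100%:R^-1); first by rewrite invr_gt0.
exists 5%N => // N /= le5N.
have N_gt0 : (0 : R) < N%:R by rewrite ltr0n; lia.
have ln_le : ln (N%:R : R) <= N%:R.
  by rewrite ltW // ltNge; apply/negP => H; have := ln_sublinear N_gt0; lra.
rewrite mulrC ler_pdivrMr //.
apply: (@le_trans _ _ (N ^ 2)%:R).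
  by rewrite natrX expr2 ler_wpM2l // ltW.
rewrite -natrM ler_nat.
apply: leq_trans (leq_mul (sqr_le_complete_count N) (leqnn 100)).
have -> : ((N %/ 5) ^ 2 * 100 = (N %/ 5 * 10) ^ 2)%N by rewrite expnMn.
by rewrite leq_exp2r //; lia.
Qed.
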